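(* Let $\mathcal{M}$ be a reversible Markov chain on a state space $\Sigma$ with stationary distribution $\pi$ and label function $\omega:\Sigma\to\mathbb{R}$, let $m\ge 1$ and $k\ge 1$ be integers and let $\varepsilon>0$. Suppose that $\sigma_0$ is chosen from $\pi$ and that $\xi$ is chosen uniformly at random from $\{1,\dots,k\}$, independently of $\sigma_0$. Sample two independent trajectories $X_1,\dots,X_\xi$ and $Y_1,\dots,Y_{k-\xi}$ of $\mathcal{M}$ from $\sigma_0$ (i.e. with $X_0=Y_0=\sigma_0$), and then branch and sample $m-1$ trajectories $Z^s_1,Z^s_2,\dots,Z^s_k$ ($2\le s\le m$), all from the state $Z^s_0=X_\xi$, which, given the state $X_\xi$, are independent of each other and of everything else sampled. Then the probability that $\omega(\sigma_0)$ is an $\varepsilon$-outlier among the list of $km$ labels $$\omega(\sigma_0);\quad \omega(X_1),\dots,\omega(X_{\xi-1});\quad \omega(Y_1),\dots,\omega(Y_{k-\xi});\quad \omega(Z^2_1),\dots,\omega(Z^2_k);\ \dots;\ \omega(Z^m_1),\dots,\omega(Z^m_k)$$ is at most $\varepsilon$. (The label $\omega(X_\xi)$ is not included in the list.)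
   Context: Markov chains are time-homogeneous, discrete-time, on a discrete (finite or countable) state space $\Sigma$, specified by transition probabilities $P(\sigma,\tau)$. A trajectory of $\mathcal{M}$ is a sequence $X_0,X_1,X_2,\dots$ of random variables with $\Pr(X_i=\sigma_i\mid X_{i-1}=\sigma_{i-1},\dots,X_0=\sigma_0)=P(\sigma_{i-1},\sigma_i)$. A trajectory is $\pi$-stationary if $X_0\sim\pi$, where $\pi$ is a stationary distribution. $\mathcal{M}$ is reversible (with respect to $\pi$) if every $\pi$-stationary trajectory $X_0,\dots,X_n$ has the same distribution as its reverse $X_n,\dots,X_0$. A real number $a_0$ is an $\varepsilon$-outlier among a finite list $a_0,\dots,a_n$ (counted with multiplicity) if $\#\{i\in\{0,\dots,n\}: a_i\le a_0\}\le \varepsilon(n+1)$. *)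

(* Defs.v *)
From HB Require Import structures.
From mathcomp Require Import all_boot all_order all_algebra.
From mathcomp Require Import all_classical all_reals.
From mathcomp Require Import ereal esum measure probability.

Set Implicit Arguments.
Unset Strict Implicit.
Unset Printing Implicit Defensive.

Import Order.TTheory GRing.Theory Num.Theory.

Local Open Scope classical_set_scope.
Local Open Scope ring_scope.

(* A finite or countable state space with the discrete sigma-algebra. *)
Definition discrete_space d (S : measurableType d) : Prop :=
  countable [set: S] /\ forall A : set S, measurable A.

Section Chains.
Context {R : realType} {dS : measure_display} {S : measurableType dS}.

Definition is_distribution (p : S -> R) : Prop :=
  (forall s, 0 <= p s) /\ \esum_(s in [set: S]) (p s)%:E = 1%E.

Definition transition_matrix (M : S -> S -> R) : Prop :=
  forall s, is_distribution (M s).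

Definition stationary (M : S -> S -> R) (q : S -> R) : Prop :=
  is_distribution q /\
  forall t, \esum_(s in [set: S]) (q s * M s t)%:E = (q t)%:E.

End Chains.

Section Events.
Context {R : realType} {d : measure_display} {T : measurableType d}.

Definition Pr (P : probability T R) (A : set T) : R := fine (P A).

(* Conditional probability given B. The definitions below are stated for a
   real-valued set function Q, so that Q may be a conditional probability;
   when Q B = 0, [cond Q B] is constantly 0 and carries no information. *)
Definition cond (Q : set T -> R) (B : set T) : set T -> R :=
  fun A => Q (A `&` B) / Q B.

(* Only used for variables with countably many values (and discrete
   sigma-algebras), for which every preimage is an event. *)
Definition independent (Q : set T -> R) (A B : Type)
    (U : T -> A) (V : T -> B) : Prop :=
  forall (E : set A) (F : set B),
    Q [set w | E (U w) /\ F (V w)] = Q [set w | E (U w)] * Q [set w | F (V w)].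

Context {dS : measure_display} {S : measurableType dS}.

(* X_0, ..., X_n *)
Definition history (X : nat -> {mfun T >-> S}) (n : nat) (w : T) : seq S :=
  [seq X i w | i <- iota 0 n.+1].

(* X_0, ..., X_n is a trajectory of M under Q. *)
Definition trajectory (Q : set T -> R) (M : S -> S -> R)
    (X : nat -> {mfun T >-> S}) (n : nat) : Prop :=
  forall (i : nat) (x : nat -> S), (i < n)%N ->
    let past := [set w | forall j, (j <= i)%N -> X j w = x j] in
    Q past != 0 ->
    cond Q past [set w | X i.+1 w = x i.+1] = M (x i) (x i.+1).

Definition has_law (Q : set T -> R) (U : {mfun T >-> S}) (q : S -> R) : Prop :=
  forall s, Q [set w | U w = s] = q s.

End Events.

Definition reversible (R : realType) dS (S : measurableType dS)
    (M : S -> S -> R) (q : S -> R) : Prop :=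
  forall d (T : measurableType d) (P : probability T R)
    (X : nat -> {RV P >-> S}) (n : nat),
    trajectory (Pr P) M X n -> has_law (Pr P) (X 0%N) q ->
    forall B : set (seq S),
      P [set w | B (history X n w)] = P [set w | B (rev (history X n w))].

(* a is an eps-outlier among the list a :: l. *)
Definition outlier (R : realType) (eps a : R) (l : seq R) : Prop :=
  (count (fun b => b <= a) (a :: l))%:R <= eps * (size (a :: l))%:R.

Section Branching.
Context {R : realType} {dS : measure_display} {S : measurableType dS}.
Context {d : measure_display} {T : measurableType d}.

(* The sampling scheme. The variables X_i with i > xi and Y_i with i > k - xi
   are not part of the sample, and nothing is assumed about their law. *)
Record branching_sample (M : S -> S -> R) (q : S -> R) (m k : nat)
    (P : probability T R) (sigma0 : {RV P >-> S}) (xi : {RV P >-> nat})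
    (X Y : nat -> {RV P >-> S}) (Z : nat -> nat -> {RV P >-> S}) : Prop := {
  sigma0_law : has_law (Pr P) sigma0 q;
  xi_uniform : forall j, (1 <= j <= k)%N ->
    Pr P [set w | xi w = j] = k%:R^-1;
  sigma0_xi_independent : independent (Pr P) sigma0 xi;
  X_start : forall w, X 0%N w = sigma0 w;
  Y_start : forall w, Y 0%N w = sigma0 w;
  X_trajectory : forall j, (1 <= j <= k)%N ->
    trajectory (cond (Pr P) [set w | xi w = j]) M X j;
  Y_trajectory : forall j, (1 <= j <= k)%N ->
    trajectory (cond (Pr P) [set w | xi w = j]) M Y (k - j);
  X_Y_independent : forall j s, (1 <= j <= k)%N ->
    independent (cond (Pr P) [set w | xi w = j /\ sigma0 w = s])
      (history X j) (history Y (k - j));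
  Z_start : forall s, (2 <= s <= m)%N -> forall w, Z s 0%N w = X (xi w) w;
  Z_trajectory : forall s, (2 <= s <= m)%N -> trajectory (Pr P) M (Z s) k;
  (* Mutual independence, given X_xi, of Z^2, ..., Z^m and the rest of the
     sample; taking some of the sets to be full gives all subfamilies. *)
  Z_independent : forall (x : S) (E : nat -> set (seq S))
      (F : set (nat * seq S * seq S)),
    let Q := cond (Pr P) [set w | X (xi w) w = x] in
    let rest w := (xi w, history X (xi w) w, history Y (k - xi w)%N w) in
    Q [set w | (forall s, (2 <= s <= m)%N -> E s (history (Z s) k w)) /\
               F (rest w)] =
    (\prod_(2 <= s < m.+1) Q [set w | E s (history (Z s) k w)]) *
    Q [set w | F (rest w)] }.

(* The labels listed after omega sigma_0. *)
Definition other_labels (omega : S -> R) (m k : nat) (P : probability T R)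
    (xi : {RV P >-> nat}) (X Y : nat -> {RV P >-> S})
    (Z : nat -> nat -> {RV P >-> S}) (w : T) : seq R :=
  [seq omega (X i w) | i <- iota 1 (xi w).-1] ++
  [seq omega (Y i w) | i <- iota 1 (k - xi w)] ++
  [seq omega (Z s i w) | s <- iota 2 m.-1, i <- iota 1 k].

End Branching.

(* Main.v *)
(* For the fixed value j of xi, detailed balance lets one read the X-branch
   backwards, so that X_j, ..., X_1, sigma0, Y_1, ..., Y_(k-j) is a trajectory
   Z^1 issued from Z^1_0 = X_j, with sigma0 = Z^1_j.  The law of (Z^1, ..., Z^m)
   restricted to xi = j is then
     k^-1 * q(Z_0) * prod_s prod_i M(Z^s_i, Z^s_(i+1)),
   which neither depends on j nor changes when rows are permuted.  Hence
   sigma0 = Z^1_xi may be traded for Z^s_j with (s, j) uniform over all km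
   positions, and at most eps * km entries of a list of length km are
   eps-outliers: the largest outlier bounds all the others. *)

Require Import Defs.
From HB Require Import structures.
From mathcomp Require Import all_boot all_order all_algebra.
From mathcomp Require Import all_classical all_reals.
From mathcomp Require Import ereal esum measure probability.
From mathcomp Require Import perm zify.

Set Implicit Arguments.
Unset Strict Implicit.
Unset Printing Implicit Defensive.

Import Order.TTheory GRing.Theory Num.Theory.

Local Open Scope classical_set_scope.
Local Open Scope ring_scope.

(** * Measurability of maps into countable sets *)

(** All preimages are asked for, so that the target needs no sigma-algebra: sequences, pairs and
    finite functions of states can be used as they are. *)
Definition discretely_measurable d (T : measurableType d) (A : Type)
    (f : T -> A) : Prop :=
  forall E : set A, measurable (f @^-1` E).

Section DiscretelyMeasurable.
Context {d : measure_display} {T : measurableType d}.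

Lemma countable_seq (A : Type) :
  countable [set: A] -> countable [set: seq A].
Proof. by case/Pcountable => A' ->; exact: countableP. Qed.

Lemma countable_ffun (I : finType) (A : Type) :
  countable [set: A] -> countable [set: {ffun I -> A}].
Proof. by case/Pcountable => A' ->; exact: countableP. Qed.

Lemma countable_pair (A B : Type) :
  countable [set: A] -> countable [set: B] -> countable [set: A * B].
Proof. by move=> cA cB; rewrite -setXTT; exact: countableX. Qed.

Lemma fibers_discretely_measurable (A : Type) (f : T -> A) :
  countable [set: A] -> (forall a, measurable [set w | f w = a]) ->
  discretely_measurable f.
Proof.
move=> cA mf E.
rewrite [X in measurable X](_ : _ =
  \bigcup_a [set w | E a /\ f w = a]); last first.
  by apply/seteqP; split => [w Ew|w [a _ [Ea fa]]];
    [exists (f w) | rewrite /= fa].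
apply: countable_bigcupT_measurable => // a.
have [Ea|nEa] := pselect (E a).
  by rewrite [X in measurable X](_ : _ = [set w | f w = a])//;
    apply/seteqP; split => w //= [].
by rewrite [X in measurable X](_ : _ = set0)//;
  apply/seteqP; split => w //= [].
Qed.

Lemma discretely_measurable_comp (A B : Type) (f : T -> A) (h : A -> B) :
  discretely_measurable f -> discretely_measurable (fun w => h (f w)).
Proof. by move=> mf E; exact: (mf (h @^-1` E)). Qed.

Lemma discretely_measurable_pair (A B : Type) (f : T -> A) (g : T -> B) :
  countable [set: A] -> countable [set: B] ->
  discretely_measurable f -> discretely_measurable g ->
  discretely_measurable (fun w => (f w, g w)).
Proof.
move=> cA cB mf mg.
apply: fibers_discretely_measurable; first exact: countable_pair.
case=> a b; rewrite [X in measurable X](_ : _ =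
  (f @^-1` [set a]) `&` (g @^-1` [set b])).
  exact: measurableI (mf _) (mg _).
by apply/seteqP; split => w /= [-> ->].
Qed.

Lemma discretely_measurable_map (A : Type) (I : Type) (l : seq I)
    (f : I -> T -> A) :
  countable [set: A] -> (forall i, discretely_measurable (f i)) ->
  discretely_measurable (fun w => [seq f i w | i <- l]).
Proof.
move=> cA mf; elim: l => [|i l IH].
  by apply: fibers_discretely_measurable; [exact: countable_seq|case=> [|? ?]];
    [rewrite [X in measurable X](_ : _ = setT)|
     rewrite [X in measurable X](_ : _ = set0)] => //; apply/seteqP; split.
apply: (@discretely_measurable_comp _ _ (fun w => (f i w, _))
  (fun p => p.1 :: p.2)).
apply: discretely_measurable_pair => //; exact: countable_seq.
Qed.

Lemma discretely_measurable_case (A : Type) (x : T -> nat) (f : nat -> T -> A) :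
  discretely_measurable x -> (forall n, discretely_measurable (f n)) ->
  discretely_measurable (fun w => f (x w) w).
Proof.
move=> mx mf E; rewrite [X in measurable X](_ : _ =
  \bigcup_n (x @^-1` [set n] `&` f n @^-1` E)).
  by apply: bigcupT_measurable => n; apply: measurableI; [exact: mx|exact: mf].
by apply/seteqP; split => [w Ew|w [n _ [/= ->]]] //; exists (x w).
Qed.

Lemma discretely_measurable_finfun (A : Type) (I : finType) (f : I -> T -> A) :
  countable [set: A] -> (forall i, discretely_measurable (f i)) ->
  discretely_measurable (fun w => [ffun i => f i w]).
Proof.
move=> cA mf; apply: fibers_discretely_measurable.
  exact: countable_ffun.
move=> a; rewrite [X in measurable X](_ : _ =
  \bigcap_i (f i @^-1` [set a i])).
  by apply: fin_bigcap_measurable => // i _; exact: mf.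
apply/seteqP; split => w /=; first by move=> <- i _; rewrite /= ffunE.
by move=> fa; apply/ffunP => i; rewrite ffunE; exact: fa.
Qed.

(** An injection of [A] into the naturals turns the fibers into a disjoint sequence, to which
    countable additivity applies; numbers outside its range give empty events. *)
Lemma measure_fibers (R : realType) (mu : {measure set T -> \bar R})
    (A : choiceType) (f : T -> A) (E : set T) :
  countable [set: A] -> discretely_measurable f -> measurable E ->
  mu E = (\esum_(a in [set: A]) mu (E `&` f @^-1` [set a]))%E.
Proof.
move=> /countable_injP[g ginj] mf mE.
have {}ginj : injective g by move=> a b; apply: ginj; rewrite inE.
have mF n : measurable (E `&` [set w | g (f w) = n]).
  exact: measurableI mE (mf (g @^-1` [set n])).
rewrite [in LHS](_ : E = \bigcup_n (E `&` [set w | g (f w) = n])); last first.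
  by apply/seteqP; split => [w Ew|w [n _ []]] //; exists (g (f w)).
rewrite measure_semi_bigcup//; last 2 first.
- apply/trivIsetP => i j _ _ ij; apply/seteqP; split => // w /= [[_ gi] [_ gj]].
  by rewrite -gi -gj eqxx in ij.
- exact: bigcupT_measurable.
rewrite nneseries_esumT// (esumID (range g))// setTI setTI.
rewrite [X in (_ + X)%E]esum1 ?adde0; last first.
  move=> n /= ng; rewrite (_ : _ `&` _ = set0) ?measure0//.
  by apply/seteqP; split => // w [_ /= gn]; apply: ng; exists (f w).
rewrite esum_image; last by move=> a b _ _; exact: ginj.
by apply: eq_esum => a _; congr (mu _); apply/seteqP;
  split => w /= [Ew /=] => [/ginj|->].
Qed.

End DiscretelyMeasurable.

(** * Null events and conditioning *)

Section Probabilities.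
Context {R : realType} {d : measure_display} {T : measurableType d}.
Variable P : probability T R.

Lemma PrE (A : set T) : measurable A -> (Pr P A)%:E = P A.
Proof. by move=> mA; rewrite /Pr fineK//; exact: fin_num_measure. Qed.

Lemma Pr_subset0 (A B : set T) : measurable A -> measurable B ->
  A `<=` B -> Pr P B = 0 -> Pr P A = 0.
Proof.
move=> mA mB AB PB0; have : (P A <= P B)%E by apply: le_measure; rewrite ?inE.
rewrite -!PrE// PB0 lee_fin => PA; apply/eqP; rewrite eq_le PA/=.
exact: fine_ge0.
Qed.

Lemma cond_subset0 (D A B : set T) : measurable D ->
  measurable A -> measurable B ->
  A `<=` B -> cond (Pr P) D B = 0 -> cond (Pr P) D A = 0.
Proof.
move=> mD mA mB AB /eqP; rewrite /cond mulf_eq0 invr_eq0.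
move=> /orP[] /eqP PB0; last by rewrite PB0 invr0 mulr0.
rewrite (@Pr_subset0 _ (B `&` D)) ?mul0r//; try exact: measurableI.
exact: setSI.
Qed.

(** [reversible] speaks of probability measures, whereas [cond] is only a real-valued set function;
    this measure links the two when [B] is not null. *)
Definition Pcond (B : set T) (mB : measurable B) : probability T R :=
  mnormalize (mrestr P mB) P.

Lemma Pr_Pcond (B : set T) (mB : measurable B) : Pr P B != 0 ->
  Pr (Pcond mB) = cond (Pr P) B.
Proof.
have fineMr (x : \bar R) (r : R) : fine (x * r%:E) = fine x * r.
  case: x => [//||]; rewrite ?mulyr ?mulNyr /= mul0r;
  by case: sgrP => _; rewrite ?mul0e ?mul1e ?mulN1e.
move=> PB0; apply/funext => A; rewrite /Pr /Pcond /= /mnormalize /cond.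
rewrite ifF /=; first by rewrite fineMr /mrestr setTI.
(* The default cases of [mnormalize], mass zero or infinite, would both give [Pr P B = 0], since
   [fine] sends infinity to 0. *)
by apply/negP => /orP[] /eqP; rewrite /mrestr setTI => PB;
  move: PB0; rewrite /Pr PB eqxx.
Qed.

End Probabilities.

(** * Laws of trajectories *)

(** Paths are functions on all naturals, so that shifting or reversing one is a change of index;
    only values up to [n] matter. *)
Definition path_weight (R : realType) (S : Type) (M : S -> S -> R)
    (n : nat) (x : nat -> S) : R :=
  \prod_(i < n) M (x i) (x i.+1).

Section Trajectories.
Context {R : realType} {dS : measure_display} {S : measurableType dS}.
Hypothesis HS : discrete_space S.
Context {d : measure_display} {T : measurableType d}.

Lemma discretely_measurable_mfun (f : {mfun T >-> S}) : discretely_measurable f.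
Proof.
by move=> E; rewrite -[X in measurable X]setTI; apply: measurable_funP => //;
  exact: HS.2.
Qed.

Lemma measurable_path (X : nat -> {mfun T >-> S}) (n : nat) (x : nat -> S) :
  measurable [set w | forall i, (i <= n)%N -> X i w = x i].
Proof.
rewrite [X in measurable X](_ : _ =
  \bigcap_(i in [set i | (i <= n)%N]) (X i @^-1` [set x i])); last first.
  by apply/seteqP; split.
by apply: bigcap_measurableType => i _; exact: discretely_measurable_mfun.
Qed.

Lemma historyP (X : nat -> {mfun T >-> S}) (n : nat) (x : nat -> S) w :
  history X n w = [seq x i | i <- iota 0 n.+1] <->
  forall i, (i <= n)%N -> X i w = x i.
Proof.
rewrite -eq_in_map; split => Xx i; have := Xx i; rewrite mem_iota add0n ltnS //.
Qed.

(** Chain rule, by induction on [n]. Only monotonicity on null sets is asked of [Q], so that [Pr P]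
    and its conditional versions are both covered. *)
Lemma trajectory_law (Q : set T -> R) (M : S -> S -> R)
    (X : nat -> {mfun T >-> S}) (n : nat) (x : nat -> S) :
  (forall A B, measurable A -> measurable B -> A `<=` B -> Q B = 0 -> Q A = 0) ->
  trajectory Q M X n ->
  Q [set w | forall i, (i <= n)%N -> X i w = x i] =
  Q [set w | X 0%N w = x 0%N] * path_weight M n x.
Proof.
move=> Q0 tX; rewrite /path_weight; elim: n tX => [|n IH] tX.
  rewrite big_ord0 mulr1; congr Q; apply/seteqP; split => w /=; first exact.
  by move=> X0 i; rewrite leqn0 => /eqP ->.
rewrite big_ord_recr/= mulrA -IH; last by move=> i y /ltnW; exact: tX.
have -> : [set w | forall i, (i <= n.+1)%N -> X i w = x i] =
    [set w | X n.+1 w = x n.+1] `&`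
    [set w | forall i, (i <= n)%N -> X i w = x i].
  apply/seteqP; split => w /=; first by move=> Xx; split => [|i /leqW]; exact: Xx.
  by move=> [Xn Xx] i; rewrite leq_eqVlt => /predU1P[->//|]; exact: Xx.
have mp := measurable_path X n x.
(* After a null past the trajectory condition says nothing, but then both sides are 0. *)
have [Qp|Qp] := eqVneq (Q [set w | forall i, (i <= n)%N -> X i w = x i]) 0.
  rewrite Qp mul0r; apply: Q0 Qp => //; apply: measurableI => //.
  exact: (@discretely_measurable_mfun (X n.+1) [set x n.+1]).
by rewrite -(tX _ _ (ltnSn n) Qp) /cond mulrCA divff// mulr1.
Qed.

End Trajectories.

(** * Time reversal under detailed balance *)

Section Reversal.
Context {R : realType} {S : Type}.
Variables (M : S -> S -> R) (q : S -> R).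
Hypothesis db : forall s t, q s * M s t = q t * M t s.

Lemma path_weight_cat n p (x : nat -> S) :
  path_weight M (n + p) x =
  path_weight M n x * path_weight M p (fun i => x (n + i)%N).
Proof.
rewrite /path_weight big_split_ord/=; congr (_ * _).
by apply: eq_bigr => i _; rewrite addnS.
Qed.

Lemma eq_path_weight n (x y : nat -> S) :
  (forall i, (i <= n)%N -> x i = y i) -> path_weight M n x = path_weight M n y.
Proof.
by move=> xy; apply: eq_bigr => i _; rewrite !xy// ltnW.
Qed.

Lemma path_weight_rev n (x : nat -> S) :
  q (x 0%N) * path_weight M n x =
  q (x n) * path_weight M n (fun i => x (n - i)%N).
Proof.
elim: n x => [|n IH] x; first by rewrite /path_weight !big_ord0.
(* Induction reverses the first [n] steps and moves [q] to [x n]; detailed balance then carries [q]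
   across the last step. *)
rewrite {1}/path_weight big_ord_recr/= mulrA -/(path_weight M n x) IH.
rewrite mulrAC db -mulrA; congr (_ * _).
rewrite /path_weight big_ord_recl/= subn0 subSS subn0; congr (_ * _).
Qed.

End Reversal.

(** * Joint law of the sample *)

Section Sample.
Context {R : realType} {dS : measure_display} {S : measurableType dS}.
Hypothesis HS : discrete_space S.
Variables (M : S -> S -> R) (q : S -> R) (m k : nat).
Hypothesis Hk : (1 <= k)%N.
Context {d : measure_display} {T : measurableType d} {P : probability T R}.
Variables (sigma0 : {RV P >-> S}) (xi : {RV P >-> nat}).
Variables (X Y : nat -> {RV P >-> S}) (Z : nat -> nat -> {RV P >-> S}).
Hypothesis Hsample : branching_sample M q m k sigma0 xi X Y Z.

Lemma discretely_measurable_rv (f : {RV P >-> S}) : discretely_measurable f.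
Proof. exact: discretely_measurable_mfun. Qed.

Lemma discretely_measurable_xi : discretely_measurable xi.
Proof.
by move=> E; rewrite -[X in measurable X]setTI; apply: measurable_funP.
Qed.

Lemma measurable_xi j : measurable [set w | xi w = j].
Proof. exact: (discretely_measurable_xi [set j]). Qed.

Lemma Pr_xi_neq0 j : (1 <= j <= k)%N -> Pr P [set w | xi w = j] != 0.
Proof.
by move=> jk; rewrite (xi_uniform Hsample)// invr_eq0 pnatr_eq0 -lt0n.
Qed.

Lemma sigma0_xi_law j s : (1 <= j <= k)%N ->
  Pr P [set w | xi w = j /\ sigma0 w = s] = k%:R^-1 * q s.
Proof.
move=> jk; rewrite -(xi_uniform Hsample jk) -(sigma0_law Hsample s) mulrC.
rewrite -[RHS](sigma0_xi_independent Hsample [set s] [set j]).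
by congr Pr; apply/seteqP; split => w [].
Qed.

Lemma branch_law j (W : nat -> {RV P >-> S}) n (x : nat -> S) :
  (1 <= j <= k)%N -> (forall w, W 0%N w = sigma0 w) ->
  trajectory (cond (Pr P) [set w | xi w = j]) M W n ->
  Pr P ([set w | forall i, (i <= n)%N -> W i w = x i] `&` [set w | xi w = j]) =
  k%:R^-1 * q (x 0%N) * path_weight M n x.
Proof.
move=> jk W0 tW.
have := trajectory_law HS x (fun A B mA mB =>
  cond_subset0 (measurable_xi j) mA mB) tW.
rewrite /cond mulrAC => /(divIf (Pr_xi_neq0 jk)) ->; congr (_ * _).
rewrite -(sigma0_xi_law _ jk); congr Pr; apply/seteqP.
by split => w /=; rewrite W0 => -[].
Qed.

Lemma measurable_two_branches j n p (x y : nat -> S) :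
  measurable [set w | [/\ xi w = j, forall i, (i <= n)%N -> X i w = x i
                        & forall i, (i <= p)%N -> Y i w = y i]].
Proof.
rewrite [X in measurable X](_ : _ = [set w | xi w = j] `&`
  ([set w | forall i, (i <= n)%N -> X i w = x i] `&`
   [set w | forall i, (i <= p)%N -> Y i w = y i])).
  by apply: measurableI; [exact: measurable_xi|
    apply: measurableI; exact: measurable_path].
by apply/seteqP; split => w /= => [[]|[? []]].
Qed.

(** The branches are independent given [xi = j] and their common start, so the product of their laws
    counts the factor [k^-1 * q] twice and is divided by it once. *)
Lemma two_branches_law j (x y : nat -> S) : (1 <= j <= k)%N -> x 0%N = y 0%N ->
  Pr P [set w | [/\ xi w = j, forall i, (i <= j)%N -> X i w = x i
                  & forall i, (i <= k - j)%N -> Y i w = y i]] =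
  k%:R^-1 * q (x 0%N) * path_weight M j x * path_weight M (k - j) y.
Proof.
move=> jk xy.
have Xl := branch_law x jk (X_start Hsample) (X_trajectory Hsample jk).
have Yl := branch_law y jk (Y_start Hsample) (Y_trajectory Hsample jk).
have := X_Y_independent Hsample (x 0%N) jk
  [set [seq x i | i <- iota 0 j.+1]]
  [set [seq y i | i <- iota 0 (k - j).+1]].
set D := [set w | xi w = j /\ sigma0 w = x 0%N].
have mD : measurable D.
  by apply: measurableI; [exact: measurable_xi|
    exact: (discretely_measurable_rv sigma0 [set x 0%N])].
have PD : Pr P D = k%:R^-1 * q (x 0%N) by exact: sigma0_xi_law.
rewrite /cond /=.
have -> : [set w | history X j w = [seq x i | i <- iota 0 j.+1]] `&` D =
  [set w | forall i, (i <= j)%N -> X i w = x i] `&` [set w | xi w = j].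
  apply/seteqP; split => w [] /= /historyP Xx => [[] //|xij]; split => //.
  by split => //; rewrite -(X_start Hsample); move/historyP: Xx; exact.
have -> : [set w | history Y (k - j) w = [seq y i | i <- iota 0 (k - j).+1]] `&` D =
  [set w | forall i, (i <= k - j)%N -> Y i w = y i] `&` [set w | xi w = j].
  apply/seteqP; split => w [] /= /historyP Yy => [[] //|xij]; split => //.
  by split => //; rewrite xy -(Y_start Hsample); move/historyP: Yy; exact.
have -> : [set w | history X j w = [seq x i | i <- iota 0 j.+1] /\
   history Y (k - j) w = [seq y i | i <- iota 0 (k - j).+1]] `&` D =
  [set w | [/\ xi w = j, forall i, (i <= j)%N -> X i w = x i
             & forall i, (i <= k - j)%N -> Y i w = y i]].
  apply/seteqP; split => w /=.
    by move=> [[/historyP Xx /historyP Yy] [xij _]].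
  move=> [xij Xx Yy]; split; first by split; apply/historyP.
  by split => //; rewrite -(X_start Hsample); exact: Xx.
(* Independence is relative to [D]. If [D] is null, so is the joint event inside it; otherwise
   [Pr P D] cancels. *)
rewrite Xl Yl -xy -PD; have [D0 _|D0] := eqVneq (Pr P D) 0.
  rewrite D0 !mul0r; apply: (Pr_subset0 _ mD _ D0); last first.
    by move=> w /= [xij Xx _]; split => //; rewrite -(X_start Hsample) Xx.
  exact: measurable_two_branches.
by rewrite !(mulrC (Pr P D)) !mulfK// => /(canRL (divfK D0)) ->; rewrite mulrAC.
Qed.

(** Reversibility has content only for trajectories that exist on some probability space. The sample
    provides one: given [xi = k], the pair [X 0], [X 1] is a one-step trajectory started from
    [q]. *)
Lemma detailed_balance : reversible M q ->
  forall s t, q s * M s t = q t * M t s.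
Proof.
move=> Hrev s t; have kk : (1 <= k <= k)%N by rewrite Hk leqnn.
have PB0 := Pr_xi_neq0 kk.
pose P' := Pcond P (measurable_xi k).
have tX : trajectory (Pr P') M X 1.
  rewrite Pr_Pcond// => i x i1; apply: (X_trajectory Hsample kk).
  exact: leq_trans i1 Hk.
have Xlaw : has_law (Pr P') (X 0%N) q.
  move=> a; rewrite Pr_Pcond// /cond.
  rewrite (_ : _ `&` _ = [set w | xi w = k /\ sigma0 w = a]).
    by rewrite sigma0_xi_law// (xi_uniform Hsample)// mulrAC divff ?mul1r//
      invr_eq0 pnatr_eq0 -lt0n.
  by apply/seteqP; split => w /=; rewrite (X_start Hsample) => -[].
have law a b : Pr P' [set w | X 0%N w = a /\ X 1%N w = b] = q a * M a b.
  have := trajectory_law HS (fun i => if i == 0%N then a else b)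
    (fun A B mA mB => @Pr_subset0 _ _ _ P' A B mA mB) tX.
  rewrite /path_weight big_ord_recl big_ord0 mulr1/= Xlaw.
  move=> <-; congr Pr; apply/seteqP; split => w /=.
    by move=> [X0 X1] [//|[]].
  by move=> Xi; rewrite (Xi 0%N)// (Xi 1%N).
have := @Hrev _ _ P' X 1%N tX Xlaw [set [:: s; t]].
rewrite -law -(law t s) /Pr /history/= /rev/= => H.
rewrite (_ : [set w | X 0%N w = s /\ _] = [set w | [:: X 0 w; X 1 w] = [:: s; t]]).
  rewrite H; congr (fine (_ _)); apply/seteqP.
  by split => w /= => [[-> ->]|[-> ->]].
by apply/seteqP; split => w /= => [[-> ->]|[-> ->]].
Qed.


(* Row 0 reads X_xi, ..., X_0 = Y_0, ..., Y_(k - xi); row s > 0 is Z^(s+1). *)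
Definition sample_row (w : T) (s i : nat) : S :=
  if s == 0%N then
    if (i <= xi w)%N then X (xi w - i)%N w else Y (i - xi w)%N w
  else Z s.+1 i w.

(** The law of [m] independent [k]-step trajectories from a common root drawn from [q], times the
    probability of one value of [xi]. *)
Definition forest_weight (c : nat -> nat -> S) : R :=
  k%:R^-1 * q (c 0%N 0%N) * \prod_(0 <= s < m) path_weight M k (c s).

Lemma sample_row0P w j (z : nat -> S) : (1 <= j <= k)%N -> xi w = j ->
  (forall i, (i <= k)%N -> sample_row w 0%N i = z i) <->
  (forall i, (i <= j)%N -> X i w = z (j - i)%N) /\
  (forall i, (i <= k - j)%N -> Y i w = z (j + i)%N).
Proof.
move=> /andP[j0 jk] xij; rewrite /sample_row/= xij; split => [rz|[Xz Yz] i ik].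
  split => i ij; first by rewrite -rz; [rewrite leq_subr subKn|lia].
  rewrite -rz; last lia; case: i ij => [|i] ij.
    (* Position [j] is where the branches meet: [X 0] and [Y 0] are both [sigma0]. *)
    by rewrite addn0 leqnn subnn (Y_start Hsample) (X_start Hsample).
  by rewrite ifF ?addKn//; lia.
by case: leqP => ij; [rewrite Xz ?subKn//; lia|rewrite Yz ?subnKC//; lia].
Qed.

(** Row 0 has the law of the two branches, rewritten by time reversal; given the root [X_xi], each
    further row contributes its own path weight. *)
Lemma forest_law j (c : nat -> nat -> S) :
  (forall s t, q s * M s t = q t * M t s) -> (1 <= j <= k)%N -> (1 <= m)%N ->
  (forall s, (s < m)%N -> c s 0%N = c 0%N 0%N) ->
  Pr P [set w | xi w = j /\
    forall s i, (s < m)%N -> (i <= k)%N -> sample_row w s i = c s i] =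
  forest_weight c.
Proof.
move=> db jk m0 c0; have /andP[j1 jk'] := jk.
(* Row 0 read from position [j] of [sigma0], backwards for [X] and forwards for [Y]. *)
pose x i := c 0%N (j - i)%N; pose y i := c 0%N (j + i)%N.
set B := [set w | X (xi w) w = c 0%N 0%N].
have mB : measurable B.
  exact: (discretely_measurable_case discretely_measurable_xi
    (fun n => discretely_measurable_rv (X n)) [set c 0%N 0%N]).
pose rest := [set w | [/\ xi w = j, forall i, (i <= j)%N -> X i w = x i
                  & forall i, (i <= k - j)%N -> Y i w = y i]].
have restB : rest `<=` B.
  by move=> w [xij Xx _]; rewrite /B/= xij Xx// /x subnn.
have mrest : measurable rest by exact: measurable_two_branches.
have Prest : Pr P rest = k%:R^-1 * q (c 0%N 0%N) * path_weight M k (c 0%N).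
  rewrite two_branches_law//; last by rewrite /x /y subn0 addn0.
  (* Reversal moves [q] from [sigma0] to the root; the two halves then join at position [j]. *)
  rewrite -(mulrA _ (q _)) path_weight_rev// /x subnn -!mulrA; congr (_ * (_ * _)).
  rewrite -[in RHS](subnKC jk') path_weight_cat; congr (_ * _).
  by apply: eq_path_weight => i ij; rewrite subKn.
pose hx := [seq x i | i <- iota 0 j.+1].
pose hy := [seq y i | i <- iota 0 (k - j).+1].
pose hz s := [seq c s.-1 i | i <- iota 0 k.+1].
have := Z_independent Hsample (c 0%N 0%N) (fun s => [set hz s]) [set (j, hx, hy)].
cbv beta zeta; rewrite -/B.
have restE w : [set (j, hx, hy)]
    (xi w, history X (xi w) w, history Y (k - xi w) w) <-> rest w.
  split; last first.
    by case=> -> Xx Yy; congr (_, _, _); apply/historyP.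
  move=> /pair_equal_spec[/pair_equal_spec[xij]].
  by rewrite xij => /historyP ? /historyP ?.
rewrite (_ : [set w | [set (j, hx, hy)] _] = rest); last first.
  by apply/seteqP; split => w /restE.
set G := [set w | _ /\ _].
have GE w : G w <-> rest w /\ forall s i, (2 <= s <= m)%N -> (i <= k)%N ->
    Z s i w = c s.-1 i.
  split=> [[Zc /restE rw]|[rw Zc]]; split; [by []| |  |exact/restE].
    by move=> s i sm; have /historyP := Zc s sm; apply.
  by move=> s sm; apply/historyP => i; exact: Zc.
have -> : [set w | xi w = j /\ forall s i,
    (s < m)%N -> (i <= k)%N -> sample_row w s i = c s i] = G.
  apply/seteqP; split => w.
    move=> [xij rc]; apply/GE; split.
      have /(sample_row0P _ jk xij)[Xx Yy] :
          forall i, (i <= k)%N -> sample_row w 0%N i = c 0%N i.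
        by move=> i ik; exact: rc.
      by split.
    by move=> [//|[//|s]] i sm ik; rewrite -[RHS]rc//; lia.
  move=> /GE[[xij Xx Yy] Zc]; split => // s i sm ik.
  case: s sm => [|s] sm; first by apply: (sample_row0P (c 0%N) jk xij).2.
  by rewrite /sample_row/= Zc.
have GB : G `<=` rest by move=> w /GE[].
have mG : measurable G.
  rewrite [X in measurable X](_ : _ = rest `&`
    \bigcap_(s in [set s | (2 <= s <= m)%N])
      [set w | forall i, (i <= k)%N -> Z s i w = c s.-1 i]).
    apply: measurableI => //; apply: bigcap_measurableType => s _.
    exact: measurable_path.
  apply/seteqP; split => w.
    by move=> /GE[rw Zc]; split => // s sm i; exact: Zc.
  by move=> [rw Zc]; apply/GE; split => // s i sm; exact: Zc.
have Gforest : forest_weight c =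
    Pr P rest * \prod_(2 <= s < m.+1) path_weight M k (c s.-1).
  by rewrite Prest /forest_weight big_add1/= (big_ltn m0) mulrA.
(* Conditioning on a null root gives no information, but then [G] and [rest], both contained in [B],
   are null as well. *)
have [B0 _|B0] := eqVneq (Pr P B) 0.
  rewrite Gforest (Pr_subset0 mrest mB restB B0) mul0r.
  exact: (Pr_subset0 mG mB (subset_trans GB restB) B0).
rewrite {1}/cond (setIidl (subset_trans GB restB)).
rewrite [cond _ _ rest]/cond (setIidl restB) mulrA.
move=> /(divIf B0) ->; rewrite Gforest mulrC; congr (_ * _).
(* [B] is also the event that [Z s] starts at the root, so conditioning on it leaves exactly the
   path weight. *)
apply: eq_big_nat => s sm.
have Zl := trajectory_law HS (c s.-1) (@Pr_subset0 _ _ _ P)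
  (Z_trajectory Hsample sm).
rewrite /cond (_ : _ `&` _ = [set w | forall i, (i <= k)%N -> Z s i w = c s.-1 i]).
  rewrite Zl (_ : [set w | Z s 0%N w = _] = B).
    by rewrite mulrAC divff ?mul1r.
  apply/seteqP; split => w; rewrite /B /= (Z_start Hsample sm) c0//; lia.
apply/seteqP; split => w /=; first by move=> [/historyP].
move=> Zc; split; first exact/historyP.
by rewrite /B/= -(Z_start Hsample sm) Zc// c0//; lia.
Qed.

(** Every row starts at [X_xi], so the event is empty. *)
Lemma forest_law0 j (c : nat -> nat -> S) (s : nat) : (1 <= j <= k)%N ->
  (s < m)%N -> c s 0%N <> c 0%N 0%N ->
  Pr P [set w | xi w = j /\
    forall s i, (s < m)%N -> (i <= k)%N -> sample_row w s i = c s i] = 0.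
Proof.
move=> jk sm cs; rewrite (_ : [set w | _] = set0) ?/Pr ?measure0//.
apply/seteqP; split => // w /= [xij rc]; apply: cs.
rewrite -!rc//; last exact: leq_ltn_trans sm.
case: s sm => // s sm; rewrite /sample_row/= (Z_start Hsample) ?subn0//; lia.
Qed.

End Sample.

(** * Counting outliers in a finite family *)

Section Outliers.
Context {R : realType} {I : finType}.
Variable eps : R.

Definition outlier_at (v : I -> R) (p : I) : bool :=
  #|[pred p' | v p' <= v p]|%:R <= eps * #|I|%:R.

Lemma card_outlier_at (v : I -> R) : 0 <= eps ->
  #|[pred p | outlier_at v p]|%:R <= eps * #|I|%:R.
Proof.
move=> eps0; have [p0 op0|no] := pickP (outlier_at v); last first.
  by rewrite eq_card0// mulr_ge0.
(* For an outlier [p] of largest value, all outliers lie among the entries counted by the outlier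
   condition at [p]. *)
case: (Order.TotalTheory.arg_maxP v op0) => p op pmax.
apply: le_trans op; rewrite ler_nat; apply/subset_leq_card/fintype.subsetP => p'.
by rewrite !inE; exact: pmax.
Qed.

Lemma outlier_at_inj (v : I -> R) (f : I -> I) (p : I) : injective f ->
  outlier_at (v \o f) p = outlier_at v (f p).
Proof.
move=> finj; congr (_%:R <= _).
by rewrite -!sum1_card [RHS](reindex_inj finj).
Qed.

End Outliers.

(** * Configurations and exchange of rows *)

Section Configurations.
Context {R : realType} {dS : measure_display} {S : measurableType dS}.
Variables (M : S -> S -> R) (q : S -> R) (m k : nat).

Let configuration := {ffun 'I_m.+1 * 'I_k.+1 -> S}.

Definition extend (c : configuration) (s i : nat) : S := c (inord s, inord i).

(** [forest_weight] reads the root in row 0 only, so configurations whose rows start at different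
    states must be given weight 0 separately. *)
Definition configuration_weight (c : configuration) : R :=
  if [forall s, c (s, ord0) == c (ord0, ord0)]
  then forest_weight M q m.+1 k (extend c) else 0.

Definition swap_rows (s : 'I_m.+1) (c : configuration) : configuration :=
  [ffun p => c (tperm ord0 s p.1, p.2)].

Lemma swap_rowsK s : involutive (swap_rows s).
Proof. by move=> c; apply/ffunP => -[s' i]; rewrite !ffunE/= tpermK. Qed.

Lemma inord0 n : inord 0 = ord0 :> 'I_n.+1.
Proof. by apply: val_inj; rewrite /= inordK. Qed.

(** The product over rows is symmetric, and [q] is evaluated at a root shared by all rows. *)
Lemma configuration_weight_swap s c :
  configuration_weight (swap_rows s c) = configuration_weight c.
Proof.
rewrite /configuration_weight.
have starts (c' : configuration) : [forall t, c' (t, ord0) == c' (ord0, ord0)] ->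
    [forall t, swap_rows s c' (t, ord0) == swap_rows s c' (ord0, ord0)].
  move=> /forallP c0; apply/forallP => t; rewrite !ffunE/=.
  by rewrite (eqP (c0 _)) eq_sym.
have -> : [forall t, swap_rows s c (t, ord0) == swap_rows s c (ord0, ord0)] =
    [forall t, c (t, ord0) == c (ord0, ord0)].
  by apply/idP/idP => [/starts|/starts//]; rewrite swap_rowsK.
case: ifPn => // /forallP c0; rewrite /forest_weight !big_mkord.
congr (_ * _ * _).
  by rewrite /extend !inord0 ffunE/= (eqP (c0 _)).
rewrite [RHS](reindex_inj (@perm_inj _ (tperm ord0 s))).
apply: eq_bigr => t _; apply: eq_path_weight => i _.
by rewrite /extend ffunE/= !inord_val.
Qed.

End Configurations.

(** * Averaging over all positions *)

Section OutlierProbability.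
Context {R : realType} {dS : measure_display} {S : measurableType dS}.
Hypothesis HS : discrete_space S.
Variables (M : S -> S -> R) (q : S -> R) (m k : nat).
Hypothesis Hk : (1 <= k)%N.
Context {d : measure_display} {T : measurableType d} {P : probability T R}.
Variables (sigma0 : {RV P >-> S}) (xi : {RV P >-> nat}).
Variables (X Y : nat -> {RV P >-> S}) (Z : nat -> nat -> {RV P >-> S}).
Hypothesis Hsample : branching_sample M q m.+1 k sigma0 xi X Y Z.
Variables (omega : S -> R) (eps : R).

Let row := sample_row xi X Y Z.

(** An arbitrary [G] serves two purposes: an indicator counts the labels below a bound, and the
    constant 1 gives the length of the list. *)
Lemma sum_other_labels w (G : R -> nat) : (1 <= xi w <= k)%N ->
  (G (omega (sigma0 w)) + \sum_(b <- other_labels omega m.+1 k xi X Y Z w) G b)%N =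
  (\sum_(s < m.+1) \sum_(i < k) G (omega (row w s i.+1)))%N.
Proof.
move=> /andP[x1 xk]; rewrite /other_labels !big_cat/= big_allpairs_dep/= !big_map.
have idx a b : iota a (b - a) = index_iota a b by [].
rewrite -subn1 idx.
have -> : iota 1 (k - xi w) = index_iota 1 (k - xi w).+1
  by rewrite /index_iota subn1.
have -> : iota 1 k = index_iota 1 k.+1 by rewrite /index_iota subn1.
have -> : iota 2 m = index_iota 2 m.+2 by rewrite /index_iota subn2.
rewrite big_ord_recl addnA addnA; congr (_ + _)%N; last first.
  rewrite big_add1 big_add1 big_mkord/=; apply: eq_bigr => s _.
  by rewrite big_add1 big_mkord.
rewrite -(big_mkord xpredT (fun i => G (omega (row w 0 i.+1)))).
rewrite -(big_add1 _ _ 0 k.+1 xpredT (fun i => G (omega (row w 0 i)))).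
(* Row 0 is cut at position [xi]: the [X] labels in reverse order come before it, [sigma0] is at it,
   and the [Y] labels come after it. *)
rewrite (big_cat_nat x1 (leqW xk))/=.
rewrite [X in (_ = _ + X)%N]big_ltn; last lia.
rewrite [X in (_ = _ + (G (omega X) + _))%N]/row /sample_row/= leqnn
  subnn (X_start Hsample).
rewrite addnCA -addnA; congr (_ + (_ + _))%N.
  rewrite [RHS]big_nat_rev/=; apply: eq_big_nat => i ix.
  rewrite /row /sample_row /= ifT; last lia.
  by congr (G (omega (X _ w))); lia.
rewrite -[(xi w).+1]add1n big_addn subSn//; apply: eq_big_nat => i ix.
rewrite /row /sample_row/= ifF; last lia.
by rewrite addnK.
Qed.

Definition configuration_of (w : T) : {ffun 'I_m.+1 * 'I_k.+1 -> S} :=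
  [ffun p : 'I_m.+1 * 'I_k.+1 => row w p.1 p.2].

(* Column 0 holds the common starting state X_xi, whose label is not listed. *)
Definition configuration_labels (c : {ffun 'I_m.+1 * 'I_k.+1 -> S})
    (p : 'I_m.+1 * 'I_k) : R := omega (c (p.1, lift ord0 p.2)).

Lemma outlier_configuration w (j : 'I_k) : xi w = j.+1 ->
  outlier eps (omega (sigma0 w)) (other_labels omega m.+1 k xi X Y Z w) <->
  outlier_at eps (configuration_labels (configuration_of w)) (ord0, j).
Proof.
move=> xij; have xk : (1 <= xi w <= k)%N by rewrite xij/=.
have lab p : configuration_labels (configuration_of w) p = omega (row w p.1 p.2.+1).
  by rewrite /configuration_labels ffunE/= /bump/= add1n.
rewrite /outlier /outlier_at lab /=.
have -> : row w 0 j.+1 = sigma0 w.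
  by rewrite /row /sample_row /= xij leqnn subnn (X_start Hsample).
set a := omega (sigma0 w).
have -> : #|[pred p' | configuration_labels (configuration_of w) p' <= a]| =
    ((a <= a)%R + count (<= a)%R (other_labels omega m.+1 k xi X Y Z w))%N.
  rewrite -[count _ _]sum1_count big_mkcond/= (sum_other_labels (fun b => b <= a))//.
  rewrite -sum1_card pair_bigA big_mkcond/=.
  by apply: eq_bigr => p _; rewrite inE lab.
have -> : (size (other_labels omega m.+1 k xi X Y Z w)).+1 =
    #|{: 'I_m.+1 * 'I_k}|.
  rewrite -[size _]sum1_size -add1n (sum_other_labels (fun=> 1%N))//.
  by rewrite -sum1_card pair_bigA.
by [].
Qed.

Lemma discretely_measurable_configuration :
  discretely_measurable configuration_of.
Proof.
apply: discretely_measurable_finfun => [|[s i]]; first exact: HS.1.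
rewrite /row /sample_row/=; case: (nat_of_ord s == 0%N);
  last exact: discretely_measurable_rv.
apply: (@discretely_measurable_case _ _ _ xi (fun n w =>
  if (i <= n)%N then X (n - i)%N w else Y (i - n)%N w)).
  exact: discretely_measurable_xi.
by move=> n; case: (i <= n)%N; exact: discretely_measurable_rv.
Qed.

Lemma configuration_law j c : (forall s t, q s * M s t = q t * M t s) ->
  (1 <= j <= k)%N ->
  Pr P ([set w | xi w = j] `&` configuration_of @^-1` [set c]) =
  configuration_weight M q c.
Proof.
move=> db jk; rewrite /configuration_weight.
have -> : [set w | xi w = j] `&` configuration_of @^-1` [set c] =
    [set w | xi w = j /\
      forall s i, (s < m.+1)%N -> (i <= k)%N -> row w s i = extend c s i].
  apply/seteqP; split => w /= -[xij].
    by move=> cE; split => // s i sm ik; rewrite -cE /extend ffunE/= !inordK.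
  move=> rc; split => //; apply/ffunP => -[s i]; rewrite ffunE/= rc ?leq_ord//.
  by rewrite /extend !inord_val.
case: ifPn => [/forallP c0|/forallPn[s cs]].
  apply: (forest_law HS Hk Hsample) => // s sm.
  by rewrite /extend inord0 (eqP (c0 _)) inord0.
apply: (forest_law0 Hsample jk (ltn_ord s)).
by rewrite /extend !inord0 inord_val; apply/eqP.
Qed.

Let outlier_event : set T :=
  [set w | outlier eps (omega (sigma0 w)) (other_labels omega m.+1 k xi X Y Z w)].

(** The event is a preimage under the countably valued tuple of all listed states, so nothing is
    needed of [omega]. *)
Lemma measurable_outlier_event : measurable outlier_event.
Proof.
have mS := discretely_measurable_rv HS.
have cS := HS.1.
have mlist (l : nat -> seq nat) (W : nat -> {RV P >-> S}) :
    discretely_measurable (fun w => [seq W i w | i <- l (xi w)]).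
  apply: (@discretely_measurable_case _ _ _ xi (fun n w =>
    [seq W i w | i <- l n])); first exact: discretely_measurable_xi.
  by move=> n; exact: discretely_measurable_map.
pose ZZ := [seq (s, i) | s <- iota 2 m, i <- iota 1 k].
pose states w := (sigma0 w, ([seq X i w | i <- iota 1 (xi w).-1],
  ([seq Y i w | i <- iota 1 (k - xi w)], [seq Z p.1 p.2 w | p <- ZZ]))).
have cL := countable_seq cS.
have mstates : discretely_measurable states.
  apply: discretely_measurable_pair => //.
    by apply: countable_pair => //; exact: countable_pair.
  apply: discretely_measurable_pair => //; first exact: countable_pair.
    exact: (mlist (fun n => iota 1 n.-1)).
  apply: discretely_measurable_pair => //.
    exact: (mlist (fun n => iota 1 (k - n))).
  by apply: discretely_measurable_map.
rewrite [X in measurable X](_ : _ = states @^-1` [set u | outlier eps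
  (omega u.1) (map omega u.2.1 ++ map omega u.2.2.1 ++ map omega u.2.2.2)]).
  exact: mstates.
apply: eq_set => w; rewrite /other_labels /= -!map_comp map_allpairs.
by [].
Qed.

Lemma outlier_event_le : 0 < eps ->
  (forall s t, q s * M s t = q t * M t s) ->
  (P outlier_event <= eps%:E)%E.
Proof.
move=> eps0 db.
have mC := discretely_measurable_configuration.
have cC : countable [set: {ffun 'I_m.+1 * 'I_k.+1 -> S}].
  exact: countable_ffun HS.1.
have mO := measurable_outlier_event.
have mx := measurable_xi (P := P) xi.
(* The [k] values of probability [k^-1] exhaust the mass, so [xi] lies in 1, ..., [k] almost
   surely. *)
pose U := \big[setU/set0]_(j < k) [set w | xi w = j.+1].
have mU : measurable U by exact: bigsetU_measurable.
have tx : trivIset setT (fun j : 'I_k => [set w | xi w = j.+1]).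
  apply/trivIsetP => i j _ _ ij; apply/seteqP; split => // w /= [-> [ji]].
  by move/eqP: ij; apply; exact: val_inj.
have PU : P U = 1%E.
  rewrite measure_bigsetU_ord//.
  rewrite (eq_bigr (fun=> (k%:R^-1)%:E)) => [|j _].
    rewrite sumEFin sumr_const card_ord -[_ *+ k]mulr_natr mulVf//.
    by rewrite pnatr_eq0 -lt0n.
  by rewrite -[X in X = _](PrE P (mx j.+1)) (xi_uniform Hsample)/=.
have PO : P outlier_event =
    (\sum_(j < k) P (outlier_event `&` [set w | xi w = j.+1]))%E.
  have <- : P (outlier_event `&` U) = P outlier_event.
    rewrite -[in RHS](setUIDK outlier_event U) measureU0//.
    - exact: measurableI.
    - exact: measurableD.
    - apply/eqP; rewrite eq_le measure_ge0 andbT.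
      apply: (@le_trans _ _ (P (~` U))).
        by apply: le_measure; rewrite ?inE; [exact: measurableD|exact: measurableC|
          move=> w []].
      by rewrite probability_setC// PU subee.
  rewrite /U big_distrr/= measure_bigsetU_ord//.
    by move=> j; exact: measurableI.
  exact: trivIset_setIl.
(* [sigma0] sits at [(ord0, j)]; exchanging rows 0 and [s] preserves the weights, so any row may
   take its place. *)
have POs (s : 'I_m.+1) : P outlier_event =
    (\sum_(j < k) \esum_(c in [set: {ffun 'I_m.+1 * 'I_k.+1 -> S}])
      (if outlier_at eps (configuration_labels c) (s, j)
       then configuration_weight M q c else 0)%:E)%E.
  rewrite PO; apply: eq_bigr => j _.
  have jk : (1 <= j.+1 <= k)%N by rewrite /= ltn_ord.
  rewrite (measure_fibers _ cC mC); last exact: measurableI.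
  rewrite [RHS](reindex_esum setT _ (swap_rows s)).
    apply: eq_esum => c _.
    rewrite configuration_weight_swap.
    have -> : outlier_at eps (configuration_labels (swap_rows s c)) (s, j) =
        outlier_at eps (configuration_labels c) (ord0, j).
      pose f (p : 'I_m.+1 * 'I_k) := (tperm ord0 s p.1, p.2).
      have finj : injective f by move=> [a b] [a' b'] [/perm_inj -> ->].
      transitivity (outlier_at eps (configuration_labels c \o f) (s, j)).
        congr outlier_at; apply/funext => p.
        by rewrite /configuration_labels ffunE.
      by rewrite outlier_at_inj// /f/= tpermR.
    case: ifPn => oc.
      rewrite -(configuration_law _ db jk) (PrE P); last first.
        by apply: measurableI => //; exact: (mC [set c]).
      congr (P _); apply/seteqP; split => w /=; first by move=> [[_ ->]].
      move=> [xij cw]; split => //; split => //.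
      by apply/(outlier_configuration xij); rewrite cw.
    rewrite (_ : _ `&` _ = set0) ?measure0//; apply/seteqP; split => // w.
    move=> /= [[ow xij] cw]; move: oc; rewrite -cw => /negP; apply.
    exact/(outlier_configuration xij).
  split => [//|a b _ _|c _]; first exact: (can_inj (swap_rowsK s)).
  by exists (swap_rows s c) => //; rewrite swap_rowsK.
have K0 : 0 <= eps * #|{: 'I_m.+1 * 'I_k}|%:R by rewrite mulr_ge0// ltW.
(* Summing over rows and swapping sums, each configuration counts at most [eps * #|I|] times its
   weight, where [I] is the set of positions. That weight is the same for all values of [xi]; taking
   [xi = 1] as representative makes the weights add up to [P(xi = 1)]. *)
have Pm : ((m.+1%:R)%:E * P outlier_event <=
    (eps * #|{: 'I_m.+1 * 'I_k}|%:R)%:E * P [set w | xi w = 1%N])%E.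
  have -> : ((m.+1%:R)%:E * P outlier_event = \sum_(s < m.+1) P outlier_event)%E.
    by rewrite -(PrE P)// -EFinM sumEFin sumr_const card_ord mulr_natl.
  under eq_bigr => s _ do rewrite (POs s).
  have w0 (c : {ffun 'I_m.+1 * 'I_k.+1 -> S}) : 0 <= configuration_weight M q c.
    rewrite -(configuration_law (j := 1) c db) ?Hk// /Pr.
    exact: fine_ge0.
  rewrite pair_bigA/= -esum_sum; last by move=> c p _ _; rewrite lee_fin; case: ifP.
  (* Scaling the measure moves the constant factor inside the sum over c. *)
  rewrite -[leRHS]/(mscale (NngNum K0) P _).
  rewrite (measure_fibers _ cC mC (mx 1%N)); apply: le_esum => c _.
  rewrite /= /mscale /= -(PrE P);
    last by apply: measurableI => //; exact: (mC [set c]).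
  rewrite configuration_law ?Hk// sumEFin -EFinM lee_fin -big_mkcond/=.
  rewrite sumr_const -[leLHS]mulr_natl ler_wpM2r//.
  apply: le_trans (card_outlier_at _ (ltW eps0)); rewrite le_eqVlt; apply/orP; left.
  apply/eqP; congr (_%:R); apply: eq_card => -[s j]; rewrite !inE//.
move: Pm; rewrite -(PrE P mO) -(PrE P (mx 1%N)) (xi_uniform Hsample) ?Hk//.
rewrite card_prod !card_ord natrM -!EFinM !lee_fin => Pm.
(* There are [m.+1 * k] positions and [P(xi = 1)] is [k^-1], so [k] cancels, then [m.+1]. *)
rewrite -(ler_pM2l (x := m.+1%:R)) ?ltr0Sn//; apply: le_trans Pm _.
by rewrite mulrA mulfK ?pnatr_eq0 -?lt0n// mulrC.
Qed.

End OutlierProbability.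

Theorem theorem6p2 (R : realType)
    (dS : measure_display) (S : measurableType dS) (HS : discrete_space S)
    (M : S -> S -> R) (q : S -> R)
    (HM : transition_matrix M) (Hq : stationary M q) (Hrev : reversible M q)
    (omega : S -> R) (m k : nat) (Hm : (1 <= m)%N) (Hk : (1 <= k)%N)
    (eps : R) (Heps : 0 < eps)
    (d : measure_display) (T : measurableType d) (P : probability T R)
    (sigma0 : {RV P >-> S}) (xi : {RV P >-> nat})
    (X Y : nat -> {RV P >-> S}) (Z : nat -> nat -> {RV P >-> S})
    (Hsample : branching_sample M q m k sigma0 xi X Y Z) :
  (P [set w | outlier eps (omega (sigma0 w))
                (other_labels omega m k xi X Y Z w)] <= eps%:E)%E.
Proof.
case: m Hm Hsample => // m' _ Hs.
apply: (outlier_event_le HS Hk Hs _ Heps).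
exact: (detailed_balance HS Hk Hs Hrev).
Qed.
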